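(* Let $\pi$ be a permutation. If the set $\mathcal V(\pi)$ of valid compositions of $\pi$ is nonempty, then $\mathcal V(\pi)$ is a transversal discrete polymatroid.
   Context: A permutation of size $n\ge 1$ is an ordering $\pi=\pi_1\cdots\pi_n$ of a set of $n$ distinct positive integers. A descent of $\pi$ is an index $i\in[n-1]$ with $\pi_i>\pi_{i+1}$. The plot of $\pi$ is the set of points $(i,\pi_i)$, $i\in[n]$. A hook of $\pi$ with southwest endpoint $(i,\pi_i)$ and northeast endpoint $(j,\pi_j)$, where $i<j$ and $\pi_i<\pi_j$, is the union of the vertical segment from $(i,\pi_i)$ to $(i,\pi_j)$ and the horizontal segment from $(i,\pi_j)$ to $(j,\pi_j)$. A point $(m,\pi_m)$ lies directly above (respectively, below) this hook if $i<m<j$ and $\pi_m>\pi_j$ (respectively, $\pi_m<\pi_j$). Let $d_1<\cdots<d_k$ be the descents of $\pi$. A valid hook configuration of $\pi$ is a tuple $\mathcal H=(H_1,\ldots,H_k)$ of hooks of $\pi$ such that: (1) $H_i$ has southwest endpoint $(d_i,\pi_{d_i})$ for each $i$; (2) no point of the plot lies directly above a hook of $\mathcal H$; (3) no two hooks of $\mathcal H$ intersect or overlap, except that the northeast endpoint of one may be the southwest endpoint of another. (If $k=0$, there is exactly one, the empty configuration.) Let $\mathrm{VHC}(\pi)$ be the set of valid hook configurations of $\pi$. Each $\mathcal H\in\mathrm{VHC}(\pi)$ induces a coloring of the $n-k$ points of the plot that are not northeast endpoints of hooks of $\mathcal H$: such a point $(m,\pi_m)$ gets the color of the lowest hook of $\mathcal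 H$ lying above it (i.e. among the hooks of $\mathcal H$ below which it lies, the one whose northeast endpoint has smallest height; a hook is not considered to lie above its own southwest endpoint), and the color of the ''sky'' if there is no such hook. Let $q_i$ be the number of points with the color of $H_i$ ($1\le i\le k$) and $q_0$ the number with the color of the sky. Then $\mathbf q^{\mathcal H}=(q_0,\ldots,q_k)$ is a composition of $n-k$ into $k+1$ (positive) parts. Set $\mathcal V(\pi)=\{\mathbf q^{\mathcal H}:\mathcal H\in\mathrm{VHC}(\pi)\}\subseteq\mathbb Z_{>0}^{k+1}$. A nonempty set $A\subseteq\mathbb Z^{k+1}$ is M-convex if for all $a,b\in A$ and every $i\in[k+1]$ with $a_i>b_i$ there is $j\in[k+1]$ with $a_j<b_j$ such that $a-e_i+e_j\in A$ and $b+e_i-e_j\in A$, where $e_1,\dots,e_{k+1}$ is the standard basis. A discrete polymatroid is a finite M-convex set contained in $\mathbb Z_{\ge0}^{k+1}$. It is transversal if it has the form $\{e_{i_1}+\cdots+e_{i_\ell}:i_j\in I_j\text{ for all }j\in[\ell]\}$ for some (not necessarily distinct) nonempty subsets $I_1,\ldots,I_\ell$ of $[k+1]$ (every set of this form is known to be a discrete polymatroid). *)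

(* Defs.v *)
From HB Require Import structures.
From mathcomp Require Import all_boot all_order all_algebra.
From mathcomp Require Import all_classical all_reals.

Set Implicit Arguments.
Unset Strict Implicit.
Unset Printing Implicit Defensive.

Import Order.TTheory GRing.Theory Num.Theory.

Local Open Scope classical_set_scope.

Definition is_permutation (n : nat) (pi : n.-tuple nat) : bool :=
  [&& 0 < n, uniq pi & all (fun x => 0 < x) pi].

(* Positions are numbered from 0, so the plot below is the usual one
   translated by one unit to the left. *)
Definition is_descent (n : nat) (pi : n.-tuple nat) (i : 'I_n) : bool :=
  [exists j : 'I_n, (j == i.+1 :> nat) && (tnth pi j < tnth pi i)].

(* In increasing order, since [enum 'I_n] is increasing. *)
Definition descents (n : nat) (pi : n.-tuple nat) : seq 'I_n :=
  [seq i <- enum 'I_n | is_descent pi i].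

Definition ndes (n : nat) (pi : n.-tuple nat) : nat := size (descents pi).

Definition descent (n : nat) (pi : n.-tuple nat) (a : 'I_(ndes pi)) : 'I_n :=
  tnth (in_tuple (descents pi)) a.

(* A hook is encoded by the positions of its southwest and northeast
   endpoints. *)
Definition hook (n : nat) : Type := ('I_n * 'I_n)%type.

Definition is_hook (n : nat) (pi : n.-tuple nat) (h : hook n) : bool :=
  (h.1 < h.2) && (tnth pi h.1 < tnth pi h.2).

Definition directly_above (n : nat) (pi : n.-tuple nat) (m : 'I_n)
    (h : hook n) : bool :=
  (h.1 < m < h.2) && (tnth pi h.2 < tnth pi m).

Definition directly_below (n : nat) (pi : n.-tuple nat) (m : 'I_n)
    (h : hook n) : bool :=
  (h.1 < m < h.2) && (tnth pi m < tnth pi h.2).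

Section Plane.
Local Open Scope ring_scope.
Variable R : realType.

Definition plot_point (n : nat) (pi : n.-tuple nat) (i : 'I_n) : R * R :=
  ((i : nat)%:R, (tnth pi i)%:R).

Definition hook_points (n : nat) (pi : n.-tuple nat) (h : hook n) :
    set (R * R) :=
  let sw := plot_point pi h.1 in
  let ne := plot_point pi h.2 in
  [set p | p.1 = sw.1 /\ sw.2 <= p.2 <= ne.2] `|`
  [set p | p.2 = ne.2 /\ sw.1 <= p.1 <= ne.1].

Definition VHC (n : nat) (pi : n.-tuple nat) :
    set ((ndes pi).-tuple (hook n)) :=
  [set H | [/\ forall a, is_hook pi (tnth H a),
               forall a, (tnth H a).1 = descent a,
               forall a m, ~~ directly_above pi m (tnth H a) &
               forall a b, a != b -> forall p,
                 hook_points pi (tnth H a) p ->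
                 hook_points pi (tnth H b) p ->
                 (p = plot_point pi (tnth H a).2 /\
                  p = plot_point pi (tnth H b).1) \/
                 (p = plot_point pi (tnth H b).2 /\
                  p = plot_point pi (tnth H a).1)]].

End Plane.

Arguments VHC R {n} pi _.

Definition is_northeast (n : nat) (pi : n.-tuple nat)
    (H : (ndes pi).-tuple (hook n)) (m : 'I_n) : bool :=
  [exists a, (tnth H a).2 == m].

Definition lowest_hook_above (n : nat) (pi : n.-tuple nat)
    (H : (ndes pi).-tuple (hook n)) (m : 'I_n) (a : 'I_(ndes pi)) : bool :=
  directly_below pi m (tnth H a) &&
  [forall b, directly_below pi m (tnth H b) ==>
             (tnth pi (tnth H a).2 <= tnth pi (tnth H b).2)].

(* Color [ord0] is the sky and color [lift ord0 a] is that of hook [a]. *)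
Definition has_color (n : nat) (pi : n.-tuple nat)
    (H : (ndes pi).-tuple (hook n)) (m : 'I_n) (c : 'I_(ndes pi).+1) : bool :=
  ~~ is_northeast H m &&
  (if unlift ord0 c is Some a then lowest_hook_above H m a
   else [forall b, ~~ directly_below pi m (tnth H b)]).

Definition composition_of (n : nat) (pi : n.-tuple nat)
    (H : (ndes pi).-tuple (hook n)) : 'rV[int]_(ndes pi).+1 :=
  (\row_c (#|[pred m | has_color H m c]|%:Z))%R.

Definition valid_compositions (R : realType) (n : nat) (pi : n.-tuple nat) :
    set 'rV[int]_(ndes pi).+1 :=
  [set composition_of H | H in VHC R pi].

Arguments valid_compositions R {n} pi _.

Section Polymatroids.
Local Open Scope ring_scope.
Variable m : nat.
Implicit Type A : set 'rV[int]_m.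

Definition std_basis (i : 'I_m) : 'rV[int]_m := delta_mx 0 i.

Definition M_convex A : Prop :=
  A !=set0 /\
  forall a b, A a -> A b -> forall i, b 0 i < a 0 i ->
    exists j, [/\ a 0 j < b 0 j,
                  A (a - std_basis i + std_basis j) &
                  A (b + std_basis i - std_basis j)].

Definition discrete_polymatroid A : Prop :=
  [/\ finite_set A, M_convex A & forall a, A a -> forall i, 0 <= a 0 i].

Definition has_transversal_form A : Prop :=
  exists (l : nat) (I : 'I_l -> {set 'I_m}),
    (forall j, exists i, i \in I j) /\
    A = [set \sum_(j < l) std_basis (f j) |
          f in [set f : 'I_l -> 'I_m | forall j, f j \in I j]].

Definition transversal_discrete_polymatroid A : Prop :=
  discrete_polymatroid A /\ has_transversal_form A.

End Polymatroids.

(* Main.v *)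
Require Import Defs.
From mathcomp Require Import all_boot all_order all_algebra.
From mathcomp Require Import all_classical all_reals.
From mathcomp Require Import zify.

Set Implicit Arguments.
Unset Strict Implicit.
Unset Printing Implicit Defensive.

Import Order.TTheory GRing.Theory Num.Theory.

(** Hooks become noncrossing arcs [d, J d] from descents to later positions.
  Let W_r(s) be the set of compositions of the permutation s followed by r
  increasing entries larger than all of s, and let s = u m v with m the maximum
  of s.  If v is empty, W_r(s) = W_(r+1)(u).  Otherwise m is a descent, its hook
  ends at one of the r new entries, and it separates the hooks starting in u
  from those starting in v, which gives
    W_r(s) = union over a + b = r, a >= 1, of W_a(u) x W_b(v).
  By induction W_r(s) is empty for r < r0 and otherwise is a fixed Minkowski sum
  of simplices plus r - r0 copies of the simplex on all the colors of s; the
  compositions of s itself are W_0(s). *)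

(** * Minkowski sums of simplices and the exchange property *)

Section Sumsets.
Local Open Scope ring_scope.
Variables (C : finType) (V : nmodType) (e : C -> V).
Implicit Types (K L : {set C}) (Ks Ls : seq {set C}) (v : V).

(** Membership in the Minkowski sum of the vertex sets [{e c | c \in K}], [K] running through [Ks].
    The list keeps multiplicities, as the transversal form requires. *)
Fixpoint in_sumset Ks v : Prop :=
  if Ks is K :: Ks' then
    exists2 c, c \in K & exists2 v', in_sumset Ks' v' & v = e c + v'
  else v = 0.

Lemma in_sumset_cat Ks Ls v :
  in_sumset (Ks ++ Ls) v <->
  exists v1 v2, [/\ in_sumset Ks v1, in_sumset Ls v2 & v = v1 + v2].
Proof.
elim: Ks v => [|K Ks IH] v /=.
  split=> [Jv|[v1 [v2 [-> Jv ->]]]]; last by rewrite add0r.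
  by exists 0, v; rewrite add0r.
split=> [[c cI [v' /IH [v1 [v2 [Iv Jv ->]]] ->]]|].
  exists (e c + v1), v2; rewrite addrA; split=> //.
  by exists c => //; exists v1.
move=> [_ [v2 [[c cI [v1 Iv ->]] Jv ->]]]; exists c => //.
exists (v1 + v2); last by rewrite addrA.
by apply/IH; exists v1, v2.
Qed.

(** Each of the [N] summands comes from [K] or from [L], and [x] and [y] count the two kinds. Read
    from right to left, this turns the union over all ways to share the tail into one Minkowski
    sum. *)
Lemma in_sumset_nseqU N K L v :
  in_sumset (nseq N (K :|: L)) v <->
  exists x y, [/\ (x + y = N)%N & in_sumset (nseq x K ++ nseq y L) v].
Proof.
elim: N v => [|N IH] v /=.
  split=> [->|[x [y [xy]]]]; first by exists 0%N, 0%N.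
  by have [-> ->] : x = 0%N /\ y = 0%N by lia.
split.
  move=> [c cIJ [v' /IH [x [y [<- /in_sumset_cat [v1 [v2 [h1 h2 ->]]]]]] ->]].
  move: cIJ; rewrite inE => /orP[cI|cJ].
    exists x.+1, y; split=> //=; exists c => //; exists (v1 + v2) => //.
    by apply/in_sumset_cat; exists v1, v2.
  exists x, y.+1; rewrite addnS; split=> //.
  apply/in_sumset_cat; exists v1, (e c + v2); rewrite addrCA; split=> //.
  by exists c => //; exists v2.
move=> [[|x] [y [xyN /in_sumset_cat [v1 [v2 [h1 h2 ->]]]]]].
  move: xyN h1 h2; rewrite add0n => -> /= -> [c cJ [v' h ->]].
  exists c; first by rewrite inE cJ orbT.
  exists v'; last by rewrite add0r.
  by apply/IH; exists 0%N, N.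
case: h1 => c cI [v' h ->]; exists c; first by rewrite inE cI.
exists (v' + v2); last by rewrite addrA.
apply/IH; exists x, y; split; first by lia.
by apply/in_sumset_cat; exists v', v2.
Qed.

Lemma in_sumset_nseq1 N c v : in_sumset (nseq N [set c]) v <-> v = e c *+ N.
Proof.
elim: N v => [|N IH] v /=; first by rewrite mulr0n.
split=> [[c' /set1P-> [v' /IH -> ->]]|->]; first by rewrite mulrS.
by exists c; [rewrite inE | exists (e c *+ N); [apply/IH | rewrite mulrS]].
Qed.

Lemma in_sumset_ord Ks v :
  in_sumset Ks v <->
  exists2 f : 'I_(size Ks) -> C,
    (forall j, f j \in nth finset.set0 Ks j) & v = \sum_(j < size Ks) e (f j).
Proof.
elim: Ks v => [|K Ks IH] v /=.
  split=> [->|[f _ ->]]; last by rewrite big_ord0.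
  by exists (fun j : 'I_0 => match notF (ltn_ord j) with end) => [[]|];
     rewrite ?big_ord0.
split=> [[c cI [v' /IH [f fI ->] ->]]|[f fI ->]].
  exists (fun j => oapp f c (unlift ord0 j)) => [j|].
    by case: unliftP => [i|] -> //=; apply: fI.
  rewrite big_ord_recl unlift_none; congr (_ + _).
  by apply: eq_bigr => i _; rewrite liftK.
exists (f ord0); first exact: (fI ord0).
exists (\sum_(j < size Ks) e (f (lift ord0 j))); last by rewrite big_ord_recl.
by apply/IH; exists (fun j => f (lift ord0 j)) => // j; apply: (fI (lift ord0 j)).
Qed.

(** An alternating path argument. Some [t] has [f t = i] and [g t != i]. If [g] takes the value
    [g t] more often than [f], then [S = {t}] works. Otherwise, once [t] is removed, [f] takes the
    value [g t] more often than [g], and the search goes on from [g t]. Exchanging [f] and [g] on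
    [S] trades one [e i] for one [e j]; the identity avoids subtraction, since [V] is only a
    monoid. *)
Lemma multiset_exchange (L : finType) (f g : L -> C) (E : {set L}) i :
  (\sum_(t in E) (g t == i) < \sum_(t in E) (f t == i))%N ->
  exists j (S : {set L}),
    (\sum_(t in E) (f t == j) < \sum_(t in E) (g t == j))%N /\
    \sum_(t in S) e (g t) + e i = \sum_(t in S) e (f t) + e j /\ S \subset E.
Proof.
move: {2}#|E| (leqnn #|E|) => N; elim: N E i => [|N IH] E i EN lt_gf.
  move: lt_gf; have -> : E = finset.set0 by apply/eqP; rewrite -cards_eq0 -leqn0.
  by rewrite !big_set0.
have [t /and3P[tE /eqP fti gti]] : exists t, [&& t \in E, f t == i & g t != i].
  apply/existsP; apply: contraTT lt_gf => /existsPn h; rewrite -leqNgt.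
  apply: leq_sum => t tE; have := h t; rewrite tE /=.
  by case: (f t == i); case: (g t == i).
have sumE (h : L -> C) k : (\sum_(s in E) (h s == k) =
    (h t == k) + \sum_(s in E :\ t) (h s == k))%N by rewrite (big_setD1 t).
have EtN : (#|E :\ t| <= N)%N by have := cardsD1 t E; rewrite tE; lia.
case: (ltnP (\sum_(s in E) (f s == g t)) (\sum_(s in E) (g s == g t)))%N => lt_gt.
  exists (g t), [set t]; rewrite !big_set1 fti addrC; split=> //; split=> //.
  by rewrite finset.sub1set.
have [|j [S [lt_j [S_sum SE]]]] := IH (E :\ t) (g t) EtN.
  have := sumE f (g t); have := sumE g (g t); rewrite eqxx fti eq_sym (negPf gti).
  by move: lt_gt => /=; lia.
have tS : t \notin S by apply/negP => /(fintype.subsetP SE); rewrite !inE eqxx.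
exists j, (t |: S); rewrite !big_setU1 //=; split; last split.
(* Removing [t] changes only the counts of [i] and [g t]; as [j] is neither, the strict inequality
   at [j] lifts from [E :\ t] to [E]. *)
- have jgt : j <> g t.
    move=> jE; have := sumE f (g t); have := sumE g (g t).
    by rewrite jE in lt_j; rewrite eqxx fti eq_sym (negPf gti); lia.
  have ji : j <> i.
    move=> jE; have := sumE f i; have := sumE g i.
    by rewrite jE in lt_j; rewrite fti eqxx (negPf gti); lia.
  rewrite !sumE fti; have -> : (i == j) = false by apply/eqP => /esym.
  have -> // : (g t == j) = false by apply/eqP => /esym.
- by rewrite fti -!addrA -S_sum addrC -addrA addrCA.
- apply/fintype.subsetP => s; rewrite !inE => /orP[/eqP->//|/(fintype.subsetP SE)].
  by rewrite inE => /andP[].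
Qed.

End Sumsets.

(** * Noncrossing arcs and their colorings *)

Section Configurations.
Local Open Scope ring_scope.
Variables (n : nat) (p : 'I_n -> nat).
Variables (C : finType) (V : nmodType) (e : C -> V) (kappa : 'I_n -> C).
Implicit Types (A D T X : {set 'I_n}) (J : 'I_n -> 'I_n) (c : C).

(* An arc [d, J d] stands for a hook; geometric crossing of hooks amounts to
   crossing of arcs because the northeast endpoint is the strict maximum. *)
Record noncrossing_arcs X D J : Prop := NoncrossingArcs {
  arc_end : forall d, d \in D -> J d \in X;
  arc_lt : forall d, d \in D -> (d < J d)%N;
  arc_max : forall d x, d \in D -> x \in X -> (d <= x < J d)%N ->
    (p x < p (J d))%N;
  arc_nested : forall d d', d \in D -> d' \in D -> (d < d' < J d)%N ->
    (J d' < J d)%N }.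

(** Among the arcs over [x], the one that starts last. By nesting its end is the lowest, so it is
    the hook that colors [x]. *)
Definition innermost D J x d :=
  [&& d \in D, (d < x < J d)%N &
      [forall d' in D, (d' < x < J d')%N ==> (d' <= d)%N]].

(** [c] is the color of the surrounding region: the sky at top level, and the color of the enclosing
    hook when the points below that hook are treated alone. *)
Definition arc_color D J c x : C :=
  if [pick d | innermost D J x d] is Some d then kappa d else c.

Definition arc_weight X D J c : V :=
  \sum_(x in X | x \notin J @: D) e (arc_color D J c x).

Definition is_weight X D c v :=
  exists2 J, noncrossing_arcs X D J & v = arc_weight X D J c.

(** In the notation of the overview, [A] holds the positions of s and [T] those of the r increasing
    larger entries after it. *)
Definition rising_tail A T :=
  (forall a t, a \in A -> t \in T -> (a < t)%N /\ (p a < p t)%N) /\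
  (forall t t', t \in T -> t' \in T -> (t < t')%N -> (p t < p t')%N).

Lemma innermost_uniq D J x d d' :
  innermost D J x d -> innermost D J x d' -> d = d'.
Proof.
move=> /and3P[dD dx /forall_inP dm] /and3P[d'D d'x /forall_inP d'm].
apply: val_inj; apply/eqP; rewrite eqn_leq.
by rewrite (implyP (dm _ d'D)) // (implyP (d'm _ dD)).
Qed.

Lemma arc_color_innermost D J c x d :
  innermost D J x d -> arc_color D J c x = kappa d.
Proof.
rewrite /arc_color; case: pickP => [d' h' h|h]; last by rewrite h.
by rewrite (innermost_uniq h h').
Qed.

Lemma innermost_exists D J x d :
  d \in D -> (d < x < J d)%N -> exists d', innermost D J x d'.
Proof.
move=> dD dx.
pose P d' := (d' \in D) && (d' < x < J d')%N.
have Pd : P d by rewrite /P dD.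
case: (arg_maxnP (fun d' : 'I_n => d' : nat) Pd) => d' /andP[d'D d'x] dm.
exists d'; rewrite /innermost d'D d'x /=.
by apply/forall_inP => d2 d2D; apply/implyP => h; apply: dm; rewrite /P d2D.
Qed.

Lemma arc_color_none D J c x :
  (forall d, d \in D -> ~~ (d < x < J d)%N) -> arc_color D J c x = c.
Proof.
move=> h; rewrite /arc_color; case: pickP => // d /and3P[dD dx _].
by rewrite (negPf (h _ dD)) in dx.
Qed.

Lemma eq_arc_color D D' J J' c x :
  (forall d, ((d \in D) && (d < x < J d)%N) = ((d \in D') && (d < x < J' d)%N)) ->
  arc_color D J c x = arc_color D' J' c x.
Proof.
move=> h; rewrite /arc_color (@eq_pick _ _ (innermost D' J' x)) // => d.
rewrite /innermost andbA h -andbA; congr (_ && (_ && _)).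
apply: eq_forallb => d'; move: (h d').
by case: (d' \in D); case: (d' \in D') => //=; first [move=> -> | move=> <-].
Qed.

Lemma eq_is_weight_tail0 T c v :
  is_weight T finset.set0 c v <-> v = e c *+ #|T|.
Proof.
have wE J : arc_weight T finset.set0 J c = e c *+ #|T|.
  rewrite /arc_weight -sumr_const; apply: eq_big => x.
    by rewrite imset0 inE andbT.
  by move=> _; rewrite arc_color_none // => d; rewrite inE.
split=> [[J _ ->]|->]; first exact: wE.
by exists id; rewrite ?wE //; split=> d; rewrite inE.
Qed.

Lemma eq_noncrossing_arcs X D J J' : {in D, J =1 J'} ->
  noncrossing_arcs X D J -> noncrossing_arcs X D J'.
Proof.
move=> eqJ [h1 h2 h3 h4].
split=> [d dD|d dD|d x dD|d d' dD d'D]; rewrite -!eqJ //;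
  [exact: h1 | exact: h2 | exact: h3 | exact: h4].
Qed.

Lemma eq_arc_weight X D J J' c : {in D, J =1 J'} ->
  arc_weight X D J c = arc_weight X D J' c.
Proof.
move=> eqJ; apply: eq_big => [x|x _]; first by rewrite (eq_in_imset eqJ).
congr e; apply: eq_arc_color => d.
by have [/eqJ ->|] := boolP (d \in D).
Qed.

(** * Splitting at the maximum when it is a descent *)

Section Split.
Variables (A D T : {set 'I_n}) (m : 'I_n) (c : C).
Hypotheses (DA : D \subset A) (tailT : rising_tail A T) (mA : m \in A)
  (mD : m \in D) (m_max : forall a, a \in A -> a != m -> (p a < p m)%N).

Let A_left := [set a in A | (a < m)%N].
Let A_right := [set a in A | (m < a)%N].
Let D_left := [set a in D | (a < m)%N].
Let D_right := [set a in D | (m < a)%N].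
(** With [t] the end of the arc of [m], [outer t] carries the arcs starting before [m] and [inner t]
    those starting after it. The point [t] is in neither, while [m] becomes a tail point for
    [A_left]; the two tails thus have [#|T|] points in all, and the outer one is never empty. *)
Let outer t := A_left :|: (m |: [set x in T | (t < x)%N]).
Let inner t := A_right :|: [set x in T | (x < t)%N].

Lemma mem_outer t x :
  (x \in outer t) = [|| (x \in A) && (x < m)%N, x == m | (x \in T) && (t < x)%N].
Proof. by rewrite !inE. Qed.

Lemma mem_inner t x :
  (x \in inner t) = ((x \in A) && (m < x)%N) || ((x \in T) && (x < t)%N).
Proof. by rewrite !inE. Qed.

Lemma tail_lt a t : a \in A -> t \in T -> (a < t)%N.
Proof. by move=> aA /(tailT.1 _ _ aA)[]. Qed.

Lemma outerP t x : t \in T -> x \in outer t ->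
  x \in A :|: T /\ ((x <= m) || (t < x))%N.
Proof.
move=> tT; rewrite mem_outer finset.in_setU => /or3P[/andP[-> h]|/eqP->|/andP[-> ->]].
- by rewrite (ltnW h).
- by rewrite mA leqnn.
- by rewrite !orbT.
Qed.

Lemma innerP t x : t \in T -> x \in inner t -> x \in A :|: T /\ (m < x < t)%N.
Proof.
move=> tT; rewrite mem_inner finset.in_setU => /orP[/andP[xA ->]|/andP[xT ->]].
  by rewrite xA (tail_lt xA tT).
by rewrite xT orbT (tail_lt mA xT).
Qed.

Lemma outerI t x : t \in T -> x \in A :|: T -> ((x <= m) || (t < x))%N ->
  x \in outer t.
Proof.
move=> tT; rewrite mem_outer finset.in_setU -val_eqE /= => xAT xmt.
have := @tail_lt x t; have := @tail_lt m x; have := tail_lt mA tT.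
move: xAT; rewrite mA tT; case: (x \in A); case: (x \in T) => //=; lia.
Qed.

Lemma innerI t x : t \in T -> x \in A :|: T -> (m < x < t)%N -> x \in inner t.
Proof.
move=> tT; rewrite mem_inner finset.in_setU => /orP[->|->] /andP[-> ->] //.
by rewrite orbT.
Qed.

(** Nesting forbids an arc starting before [m] to end in the interval from [m + 1] to [J m], and
    forces an arc starting after [m] to end before [J m]. Conversely, the height conditions lost by
    restriction follow from the rising tail. *)
Lemma noncrossing_arcs_split J :
  noncrossing_arcs (A :|: T) D J <->
  [/\ J m \in T, noncrossing_arcs (outer (J m)) D_left J &
      noncrossing_arcs (inner (J m)) D_right J].
Proof.
have D_leftP d : d \in D_left -> d \in D /\ (d < m)%N by rewrite inE => /andP.
have D_rightP d : d \in D_right -> d \in D /\ (m < d)%N by rewrite inE => /andP.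
split=> [[J_in J_lt J_max J_nest]|[tT [in1 lt1 max1 nest1] [in2 lt2 max2 nest2]]].
  (* The end of the arc is higher than [m], which is the maximum of [A]. *)
  have tT : J m \in T.
    have := J_in _ mD; rewrite inE => /orP[tA|//].
    have mt : (m < J m)%N := J_lt _ mD.
    have := J_max m m mD; rewrite inE mA leqnn mt /= => /(_ isT isT) pmt.
    have : J m != m by rewrite -val_eqE /=; lia.
    by move=> /(m_max tA); lia.
  split=> //; split.
  - move=> d /D_leftP[dD dm]; apply: outerI => //; first exact: J_in.
    have := J_nest _ _ dD mD; lia.
  - by move=> d /D_leftP[dD dm]; apply: J_lt.
  - by move=> d x /D_leftP[dD dm] /(outerP tT)[xAT _]; apply: J_max.
  - by move=> d d' /D_leftP[dD _] /D_leftP[d'D _]; apply: J_nest.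
  - move=> d /D_rightP[dD dm].
    have JdAT := J_in _ dD; have dJ := J_lt _ dD.
    case: (ltnP d (J m)) => [dt|td].
      by have := J_nest _ _ mD dD; rewrite dm dt => h; apply: innerI => //; lia.
    have := tail_lt (fintype.subsetP DA _ dD) tT; lia.
  - by move=> d /D_rightP[dD dm]; apply: J_lt.
  - by move=> d x /D_rightP[dD dm] /(innerP tT)[xAT _]; apply: J_max.
  - by move=> d d' /D_rightP[dD _] /D_rightP[d'D _]; apply: J_nest.
have mt := tail_lt mA tT.
have cases d : d \in D -> [\/ d \in D_left, d = m | d \in D_right].
  move=> dD; rewrite !inE dD /=.
  by case: (ltngtP d m) => [h|h|/val_inj];
    [constructor 1|constructor 3|constructor 2].
have J1P d : d \in D_left ->
    [/\ (d < J d)%N, J d \in A :|: T & ((J d <= m) || (J m < J d))%N].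
  by move=> dD; have [] := outerP tT (in1 _ dD); split=> //; exact: lt1.
have J2P d : d \in D_right ->
    [/\ (d < J d)%N, J d \in A :|: T & (m < J d < J m)%N].
  by move=> dD; have [] := innerP tT (in2 _ dD); split=> //; exact: lt2.
split.
- move=> d /cases[/J1P[]//|->|/J2P[]//]; by rewrite inE tT orbT.
- by move=> d /cases[/J1P[]//|->|/J2P[]//].
- move=> d x /cases[d_left|->|d_right] xAT dx.
  + have [dJ JAT Jd] := J1P _ d_left.
    (* An arc that ends beyond [m] ends in [T], hence above every earlier point, including those
       under the arc of [m]. *)
    case: (leqP (J d) m) => Jdm.
      by apply: max1 => //; apply: outerI => //; lia.
    have JT : J d \in T.
      have : J d \in outer (J m) by apply: in1.
      by rewrite mem_outer -val_eqE /= => /or3P[|/eqP|/andP[]//]; lia.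
    move: xAT; rewrite inE => /orP[xA|xT]; first by have [] := tailT.1 _ _ xA JT.
    by apply: tailT.2 => //; lia.
  + move: xAT; rewrite inE => /orP[xA|xT]; first by have [] := tailT.1 _ _ xA tT.
    by apply: tailT.2 => //; lia.
  + have [dJ JAT Jd] := J2P _ d_right.
    by apply: max2 => //; apply: innerI => //; have := D_rightP _ d_right; lia.
- move=> d d' /cases[dD|->|dD] /cases[d'D|->|d'D] dd'.
  + exact: nest1.
  + by have [] := J1P _ dD; lia.
  + have [] := J1P _ dD; have [] := J2P _ d'D; have := D_rightP _ d'D; lia.
  + have := D_leftP _ d'D; lia.
  + lia.
  + have [] := J2P _ d'D; lia.
  + have := D_rightP _ dD; have := D_leftP _ d'D; lia.
  + have := D_rightP _ dD; lia.
  + exact: nest2.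
Qed.

(** The only point in neither part is [J m], a northeast endpoint, which is not counted. Outer
    points lie under left arcs only. Over an inner point, left arcs start before [m], so the arc of
    [m] takes precedence and [kappa m] acts as the surrounding color. *)
Lemma arc_weight_split J : noncrossing_arcs (A :|: T) D J ->
  arc_weight (A :|: T) D J c =
  arc_weight (outer (J m)) D_left J c +
  arc_weight (inner (J m)) D_right J (kappa m).
Proof.
move=> /noncrossing_arcs_split[tT nc1 nc2].
have mt := tail_lt mA tT.
have D_leftP d : (d \in D_left) = (d \in D) && (d < m)%N by rewrite inE.
have D_rightP d : (d \in D_right) = (d \in D) && (m < d)%N by rewrite inE.
have J1P d : d \in D -> (d < m)%N -> ((J d <= m) || (J m < J d))%N.
  move=> dD dm; have [] := outerP tT (arc_end nc1 (d := d) _) => //.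
  by rewrite D_leftP dD.
have J2P d : d \in D -> (m < d)%N -> (m < J d < J m)%N.
  move=> dD dm; have [] := innerP tT (arc_end nc2 (d := d) _) => //.
  by rewrite D_rightP dD.
rewrite /arc_weight (bigID (fun x => x \in outer (J m))) /=; congr (_ + _).
  apply: eq_big => [x|x /andP[_ /(outerP tT)[_ xm]]].
    have [x_outer|] := boolP (x \in outer (J m)); last by rewrite andbF.
    have [-> xm] := outerP tT x_outer; rewrite andbT /=; congr (~~ _).
    apply/imsetP/imsetP => [[d dD xE]|[d]]; last first.
      by rewrite D_leftP => /andP[dD _] ->; exists d.
    exists d => //; rewrite D_leftP dD /=; move: xm; rewrite xE.
    case: (ltngtP d m) => // [/(J2P _ dD)|/val_inj->]; lia.
  congr e; apply: eq_arc_color => d; rewrite D_leftP.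
  have [dD|//] := boolP (d \in D).
  case: (ltngtP d m) => //= [dm|/val_inj->]; last by lia.
  by have := J2P _ dD dm; lia.
apply: eq_big => [x|x /andP[/andP[xAT xND] x_not_outer]].
  have [x_inner|] := boolP (x \in inner (J m)).
    have [-> xm] := innerP tT x_inner.
    have -> : x \notin outer (J m) by apply/negP => /(outerP tT)[_]; lia.
    rewrite andbT /=; congr (~~ _).
    apply/imsetP/imsetP => [[d dD xE]|[d]]; last first.
      by rewrite D_rightP => /andP[dD _] ->; exists d.
    exists d => //; rewrite D_rightP dD /=; move: xm; rewrite xE.
    case: (ltngtP d m) => // [/(J1P _ dD)|/val_inj->]; lia.
  apply: contraNF => /andP[/andP[xAT xND] x_not_outer]; apply: innerI => //.
  have : x != J m by apply: contraNN xND => /eqP->; apply: imset_f.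
  rewrite -val_eqE /=.
  have : ~~ ((x <= m) || (J m < x))%N by apply: contraNN x_not_outer; apply: outerI.
  lia.
have mx : (m < x < J m)%N.
  have : x != J m by apply: contraNN xND => /eqP->; apply: imset_f.
  rewrite -val_eqE /=.
  have : ~~ ((x <= m) || (J m < x))%N by apply: contraNN x_not_outer; apply: outerI.
  lia.
congr e.
(* If a right arc covers [x], the innermost one is also innermost in [D], since it starts after [m];
   otherwise the arc of [m] is innermost. *)
have [/existsP[d /andP[d_right dx]]|] :=
  boolP [exists d, (d \in D_right) && (d < x < J d)%N].
  have [d' inn] := innermost_exists d_right dx.
  rewrite (arc_color_innermost _ inn).
  apply: arc_color_innermost; move: inn; rewrite /innermost D_rightP.
  move=> /and3P[/andP[-> md'] -> /forall_inP h] /=.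
  apply/forall_inP => d2 d2D; apply/implyP => d2x.
  case: (ltnP m d2) => d2m; last by lia.
  by have := h d2; rewrite D_rightP d2D d2m d2x; apply.
rewrite negb_exists => /forallP no_right.
rewrite (@arc_color_none D_right); last first.
  by move=> d d_right; have := no_right d; rewrite d_right.
apply: arc_color_innermost; rewrite /innermost mD mx /=.
apply/forall_inP => d2 d2D; apply/implyP => d2x; rewrite leqNgt.
by apply/negP => d2m; have := no_right d2; rewrite D_rightP d2D d2m d2x.
Qed.

(** Once the end [t] of the arc of [m] is fixed, the arcs on its two sides can be chosen
    independently and glued. *)
Lemma is_weight_split v :
  is_weight (A :|: T) D c v <->
  exists t v1 v2, [/\ t \in T, is_weight (outer t) D_left c v1,
    is_weight (inner t) D_right (kappa m) v2 & v = v1 + v2].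
Proof.
split=> [[J nc ->]|[t [_ [_ [tT [J1 nc1 ->] [J2 nc2 ->] ->]]]]].
  have [tT nc1 nc2] := (noncrossing_arcs_split J).1 nc.
  exists (J m), (arc_weight (outer (J m)) D_left J c),
    (arc_weight (inner (J m)) D_right J (kappa m)); split=> //; try by exists J.
  exact: arc_weight_split.
pose J (d : 'I_n) := if (d < m)%N then J1 d else if (m < d)%N then J2 d else t.
have eq1 : {in D_left, J1 =1 J} by move=> d; rewrite inE /J => /andP[_ ->].
have eq2 : {in D_right, J2 =1 J}.
  by move=> d; rewrite inE /J => /andP[_ md]; rewrite md ltnNge (ltnW md).
have Jm : J m = t by rewrite /J !ltnn.
have nc : noncrossing_arcs (A :|: T) D J.
  apply/noncrossing_arcs_split; rewrite Jm; split=> //.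
    exact: eq_noncrossing_arcs nc1.
  exact: eq_noncrossing_arcs nc2.
exists J => //; rewrite (arc_weight_split nc) Jm.
by rewrite (eq_arc_weight _ _ eq1) (eq_arc_weight _ _ eq2).
Qed.

End Split.
End Configurations.

(** * The recursion on the maximum *)

Section Recursion.
Local Open Scope ring_scope.
Variables (n : nat) (p : 'I_n -> nat).
Variables (C : finType) (V : nmodType) (e : C -> V) (kappa : 'I_n -> C).
Implicit Types (A D T X : {set 'I_n}) (J : 'I_n -> 'I_n) (c : C).

(** Removing the largest element, of rank [#|T| - 1], leaves the other ranks unchanged. The lemma
    realizes any prescribed size of the inner tail. *)
Lemma exists_rank T k : (k < #|T|)%N ->
  exists2 t, t \in T & #|[set x in T | (x < t)%N]| = k.
Proof.
move: {2}#|T| (leqnn #|T|) => N; elim: N T k => [|N IH] T k; first by lia.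
move=> TN kT.
have [t0 t0T] : exists t, t \in T by apply/card_gt0P; lia.
case: (arg_maxnP (fun t : 'I_n => t : nat) t0T) => t tT t_max.
have cardT : #|T| = #|T :\ t|.+1 by rewrite (cardsD1 t) (tT : t \in T).
case: (ltnP k #|T :\ t|) => kt; last first.
  exists t => //; rewrite (_ : [set x in T | _] = T :\ t); first by lia.
  apply/setP => x; rewrite !inE -val_eqE /= andbC.
  have [xT|] := boolP (x \in T); rewrite ?andbF //= !andbT.
  by have := t_max x xT; lia.
have [|s sT <-] := IH (T :\ t) k _ kt; first by lia.
exists s; first by case/setD1P: sT.
apply: eq_card => x; rewrite !inE -val_eqE /=.
have [xT|] := boolP (x \in T); rewrite ?andbF //= andbT.
have sT' : s \in T by case/setD1P: sT.
by have := t_max s sT'; lia.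
Qed.

Lemma card_split_rank T t : t \in T ->
  #|T| = (#|[set x in T | (t < x)%N]| + #|[set x in T | (x < t)%N]|).+1.
Proof.
move=> tT; rewrite (cardsD1 t) tT add1n; congr _.+1.
rewrite -cardsUI (_ : _ :&: _ = finset.set0) ?cards0 ?addn0.
  by apply: eq_card => x; rewrite !inE -val_eqE /=; case: (x \in T) => //=; lia.
by apply/setP => x; rewrite !inE; case: (x \in T) => //=; lia.
Qed.

(** Adjacency is relative to [A], so that the property passes to both sides of [m]. It ensures that
    a maximum of [A] outside [D] is the last element of [A]. *)
Definition contains_descents A D :=
  forall a b, a \in A -> b \in A -> (a < b)%N -> (p b < p a)%N ->
    (forall x, x \in A -> ~~ (a < x < b)%N) -> a \in D.

(** Since [r0] and [Ks] are chosen before [T], the induction hypothesis applies to all the tails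
    that arise from different ends [t]. *)
Lemma is_weight_sumset A D c : injective p -> D \subset A ->
  contains_descents A D ->
  exists r0 Ks, forall T, rising_tail p A T -> forall v,
    is_weight p e kappa (A :|: T) D c v <->
    (r0 <= #|T|)%N /\
    in_sumset e (Ks ++ nseq (#|T| - r0) (c |: kappa @: D)) v.
Proof.
move=> p_inj; move: {2}#|A| (leqnn #|A|) => N.
elim: N A D c => [|N IH] A D c AN DA desc.
  have A0 : A = finset.set0 by apply/eqP; rewrite -cards_eq0 -leqn0.
  have D0 : D = finset.set0 by apply/eqP; rewrite -finset.subset0 -A0.
  exists 0%N, [::] => T _ v; rewrite A0 D0 finset.set0U imset0 finset.setU0 subn0 /=.
  rewrite eq_is_weight_tail0 in_sumset_nseq1.
  by split=> [|[]].
have [A0|[a0 a0A]] := set_0Vmem A; first by apply: IH => //; rewrite A0 cards0.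
case: (arg_maxnP p a0A) => m mA m_max'.
have m_max a : a \in A -> a != m -> (p a < p m)%N.
  move=> aA am; rewrite ltn_neqAle (m_max' a aA : (p a <= p m)%N) andbT.
  by apply: contraNN am => /eqP/p_inj->.
pose A1 := [set a in A | (a < m)%N]; pose D1 := [set a in D | (a < m)%N].
pose A2 := [set a in A | (m < a)%N]; pose D2 := [set a in D | (m < a)%N].
have A1N : (#|A1| <= N)%N.
  rewrite -ltnS; apply: leq_trans AN; apply: proper_card; apply/properP; split.
    by apply/fintype.subsetP => x; rewrite inE => /andP[].
  by exists m => //; rewrite inE ltnn andbF.
have A2N : (#|A2| <= N)%N.
  rewrite -ltnS; apply: leq_trans AN; apply: proper_card; apply/properP; split.
    by apply/fintype.subsetP => x; rewrite inE => /andP[].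
  by exists m => //; rewrite inE ltnn andbF.
have D1A1 : D1 \subset A1.
  by apply/fintype.subsetP => x; rewrite !inE => /andP[/(fintype.subsetP DA)-> ->].
have D2A2 : D2 \subset A2.
  by apply/fintype.subsetP => x; rewrite !inE => /andP[/(fintype.subsetP DA)-> ->].
have desc1 : contains_descents A1 D1.
  move=> a b; rewrite !inE => /andP[aA am] /andP[bA bm] ab pab cons.
  rewrite am andbT; apply: (desc a b) => // x xA.
  by have := cons x; rewrite inE xA; case: (ltnP x m) => xm; [apply | lia].
have desc2 : contains_descents A2 D2.
  move=> a b; rewrite !inE => /andP[aA am] /andP[bA bm] ab pab cons.
  rewrite am andbT; apply: (desc a b) => // x xA.
  by have := cons x; rewrite inE xA; case: (ltnP m x) => xm; [apply | lia].
have [r1 [K1 IH1]] := IH A1 D1 c A1N D1A1 desc1.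
have [r2 [K2 IH2]] := IH A2 D2 (kappa m) A2N D2A2 desc2.
have [mD|mND] := boolP (m \in D).
  (* The color of [m] enters [F2] as the surrounding color of the right part, so the two color sets
     together exhaust [c |: kappa @: D]. *)
  set F1 := c |: _ in IH1; set F2 := kappa m |: _ in IH2.
  have -> : c |: kappa @: D = F1 :|: F2.
    have -> : D = D1 :|: (m |: D2).
      apply/setP => x; rewrite !inE -val_eqE /=; have [xD|xND] := boolP (x \in D).
        by rewrite /=; lia.
      by rewrite /= orbF; apply/esym/negbTE; apply: contraNN xND => /eqP/val_inj->.
    by rewrite !imsetU imset_set1 finset.setUA.
  (* The outer tail contains [m], so its size is at least 1 as well as at least [r1]. If [r1 = 0],
     this forces one copy of [F1], recorded by [nseq (1 - r1) F1]. *)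
  exists (maxn 1 r1 + r2)%N, ((K1 ++ nseq (1 - r1) F1) ++ K2) => T tailT v.
  have tail1 t : t \in T -> rising_tail p A1 (m |: [set x in T | (t < x)%N]).
    move=> tT; split=> [a x|x x'].
      rewrite !inE => /andP[aA am] /orP[/eqP->|/andP[xT _]].
        by split=> //; apply: m_max => //; rewrite -val_eqE /=; lia.
      exact: tailT.1.
    rewrite !inE => /orP[/eqP->|/andP[xT tx]] /orP[/eqP->|/andP[x'T tx']] xx'.
    - by rewrite ltnn in xx'.
    - by have [] := tailT.1 _ _ mA x'T.
    - by have [] := tailT.1 _ _ mA xT; lia.
    - exact: tailT.2.
  have tail2 t : t \in T -> rising_tail p A2 [set x in T | (x < t)%N].
    move=> tT; split=> [a x|x x'].
      rewrite !inE => /andP[aA am] /andP[xT _]; exact: tailT.1.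
    by rewrite !inE => /andP[xT _] /andP[x'T _]; apply: tailT.2.
  have card1 t : t \in T ->
      #|m |: [set x in T | (t < x)%N]| = #|[set x in T | (t < x)%N]|.+1.
    move=> tT; rewrite cardsU1 inE negb_and.
    suff -> : m \notin T by [].
    by apply/negP => mT; have [] := tailT.1 _ _ mA mT; rewrite ltnn.
  rewrite (is_weight_split _ _ _ DA tailT mA mD m_max); split.
    move=> [t [v1 [v2 [tT]]]].
    move=> /(IH1 _ (tail1 t tT))[le1 in1] /(IH2 _ (tail2 t tT))[le2 in2] ->.
    rewrite (card1 t tT) in le1 in1.
    have cT := card_split_rank tT.
    split; first by lia.
    set x := #|[set x in T | (t < x)%N]| in le1 in1 cT.
    set y := #|[set x in T | (x < t)%N]| in le2 in2 cT.
    have xE : (x.+1 - r1 = (1 - r1) + (x.+1 - maxn 1 r1))%N by lia.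
    move: in1; rewrite xE nseqD catA => /in_sumset_cat[w1 [w2 [hw1 hw2 ->]]].
    move/in_sumset_cat: in2 => [w3 [w4 [hw3 hw4 ->]]].
    rewrite -addrA (addrCA w2) addrA.
    apply/in_sumset_cat; exists (w1 + w3), (w2 + w4); split=> //.
      by apply/in_sumset_cat; exists w1, w3.
    (* The tail points beyond the two thresholds contribute copies of [F1] and [F2] respectively. *)
    apply/in_sumset_nseqU; exists (x.+1 - maxn 1 r1)%N, (y - r2)%N.
    split; first by lia.
    by apply/in_sumset_cat; exists w2, w4.
  move=> [leT /in_sumset_cat[w [w' [/in_sumset_cat[w1 [w3 [hw1 hw3 ->]]] + ->]]]].
  move/in_sumset_nseqU => [x [y [xy /in_sumset_cat[w2 [w4 [hw2 hw4 ->]]]]]].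
  (* The arc of [m] ends where exactly [r2 + y] tail points are left inside, giving [y] free copies
     of [F2] and [x] of [F1]. *)
  have [|t tT ty] := @exists_rank T (r2 + y)%N; first by lia.
  have cT := card_split_rank tT.
  exists t, (w1 + w2), (w3 + w4); rewrite -!addrA (addrCA w3); split=> //.
    apply/(IH1 _ (tail1 t tT)); rewrite (card1 t tT); split; first by lia.
    have -> : (#|[set x in T | (t < x)%N]|.+1 - r1 = (1 - r1) + x)%N by lia.
    by rewrite nseqD catA; apply/in_sumset_cat; exists w1, w2.
  apply/(IH2 _ (tail2 t tT)); rewrite ty addKn; split; first by lia.
  by apply/in_sumset_cat; exists w3, w4.
(* If [A] had an element after [m], the next one would be lower and make [m] a descent. *)
have A1E : A = m |: A1.
  apply/setP => x; rewrite !inE -val_eqE /=.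
  have [xA|] := boolP (x \in A); last first.
    by move=> xNA; rewrite orbF; apply/esym/negbTE; apply: contraNN xNA => /eqP/val_inj->.
  case: (ltngtP x m) => //= mx; apply/esym/negP => _; case/negP: mND.
  pose above_m y := (y \in A) && (m < y)%N.
  have Px : above_m x by rewrite /above_m xA.
  case: (arg_minnP (fun x : 'I_n => x : nat) Px) => b /andP[bA mb] b_min.
  apply: (desc m b) => //; first by apply: m_max => //; rewrite -val_eqE /=; lia.
  move=> y yA; apply/negP => /andP[my yb].
  by have := b_min y; rewrite /above_m yA my => /(_ isT); lia.
have DE : D = D1.
  apply/setP => x; rewrite !inE; have [xD|//] := boolP (x \in D).
  have := fintype.subsetP DA _ xD; rewrite A1E !inE => /orP[/eqP xm|/andP[_ -> //]].
  by rewrite -xm xD in mND.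
(* Here [m] joins the tail, which lowers the threshold by one. If [r1 = 0] the subtraction
   truncates, and the surplus tail point gives a fixed copy of the full simplex. *)
exists (r1 - 1)%N, (K1 ++ nseq (1 - r1) (c |: kappa @: D)) => T tailT v.
have tail1 : rising_tail p A1 (m |: T).
  split=> [a t|t t']; rewrite !inE.
    move=> /andP[aA am] /orP[/eqP->|]; last exact: tailT.1.
    by split=> //; apply: m_max => //; rewrite -val_eqE /=; lia.
  move=> /orP[/eqP->|tT] /orP[/eqP->|t'T] tt'.
  - by rewrite ltnn in tt'.
  - by have [] := tailT.1 _ _ mA t'T.
  - by have [] := tailT.1 _ _ mA tT; lia.
  - exact: tailT.2.
have cT : #|m |: T| = #|T|.+1.
  rewrite cardsU1; suff -> : m \notin T by [].
  by apply/negP => mT; have [] := tailT.1 _ _ mA mT; rewrite ltnn.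
have -> : A :|: T = A1 :|: (m |: T) by rewrite {1}A1E finset.setUA (finset.setUC A1).
rewrite -catA -nseqD.
have -> : ((1 - r1) + (#|T| - (r1 - 1)) = #|T|.+1 - r1)%N by lia.
have -> : (r1 - 1 <= #|T|)%N = (r1 <= #|T|.+1)%N by lia.
by rewrite -cT {1 2}DE; apply: IH1.
Qed.

End Recursion.

(** * From Minkowski sums to transversal discrete polymatroids *)

Section Transversal.
Local Open Scope ring_scope.
Local Open Scope classical_set_scope.
Variables (k : nat).

Lemma sum_std_basisE l (f : 'I_l -> 'I_k) (i : 'I_k) :
  (\sum_j std_basis (f j)) 0 i = (\sum_j (f j == i))%N%:Z.
Proof.
rewrite summxE -natz natr_sum; apply: eq_bigr => j _.
by rewrite mxE eqxx /= eq_sym; case: (_ == _).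
Qed.

(** For M-convexity, the choice functions [f] and [g] of two points are exchanged on the set [S]
    from [multiset_exchange]. Both results stay admissible, because [f t] and [g t] lie in the same
    [K t]. *)
Lemma transversal_form_polymatroid (A : set 'rV[int]_k) :
  has_transversal_form A -> A !=set0 -> discrete_polymatroid A.
Proof.
move=> [l [K [_ ->]]] A0; split.
- apply: (@sub_finite_set _ _
    [set \sum_j std_basis (f j) | f in [set: {ffun 'I_l -> 'I_k}]]).
    move=> _ [f _ <-]; exists [ffun j => f j] => //.
    by apply: eq_bigr => j _; rewrite ffunE.
  exact: finite_image.
- split=> // _ _ [f fK <-] [g gK <-] i; rewrite !sum_std_basisE ltz_nat => lt_gf.
  have fullE (h : 'I_l -> 'I_k) c :
      (\sum_(t in [set: 'I_l]%SET) (h t == c) = \sum_t (h t == c))%N.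
    by apply: eq_bigl => t; rewrite inE.
  have [|j [S [lt_j [S_sum _]]]] :=
    multiset_exchange (@std_basis k) (f := f) (g := g)
      (E := [set: 'I_l]%SET) (i := i).
    by rewrite !fullE.
  rewrite !fullE in lt_j.
  have swap (f1 g1 : 'I_l -> 'I_k) :
      \sum_t std_basis (if t \in S then g1 t else f1 t) =
      \sum_t std_basis (f1 t) + (\sum_(t in S) std_basis (g1 t)
        - \sum_(t in S) std_basis (f1 t)).
    rewrite (bigID (mem S)) [X in _ = X + _](bigID (mem S)) /=.
    rewrite [X in X + _ = _](eq_bigr (fun t => std_basis (g1 t))); last first.
      by move=> t ->.
    rewrite [X in _ + X = _](eq_bigr (fun t => std_basis (f1 t))); last first.
      by move=> t /negPf->.
    by rewrite [RHS]addrC addrA subrK.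
  have SgE : \sum_(t in S) std_basis (g t) =
      \sum_(t in S) std_basis (f t) + (std_basis j - std_basis i).
    by rewrite addrA -S_sum addrK.
  exists j; split.
  + by rewrite !sum_std_basisE ltz_nat.
  + exists (fun t => if t \in S then g t else f t).
      by move=> t; case: ifP.
    by rewrite swap SgE (addrC (\sum_(t in S) _)) addrK addrA addrAC.
  + exists (fun t => if t \in S then f t else g t).
      by move=> t; case: ifP.
    by rewrite swap SgE opprD addrA addrA addrK opprB addrA.
- move=> _ [f _ <-] i; by rewrite sum_std_basisE.
Qed.

(** A point of [A] selects an element of each set in [Ks], so all these sets are nonempty. *)
Lemma in_sumset_transversal_form (Ks : seq {set 'I_k}) (A : set 'rV[int]_k) :
  (forall v, A v <-> in_sumset (@std_basis k) Ks v) -> A !=set0 ->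
  has_transversal_form A.
Proof.
move=> AE [a /AE/in_sumset_ord[f fK _]].
exists (size Ks), (fun j => nth finset.set0 Ks j).
split=> [j|]; first by exists (f j).
apply/seteqP; split=> v.
  by move=> /AE/in_sumset_ord[g gK ->]; exists g.
by move=> [g gK <-]; apply/AE/in_sumset_ord; exists g.
Qed.

End Transversal.

(** * Valid hook configurations as noncrossing arcs *)

Section Hooks.
Local Open Scope ring_scope.
Variables (R : realType) (n : nat) (pi : n.-tuple nat).
Hypothesis pi_uniq : uniq pi.

Let D := [set i | is_descent pi i]%SET.

Lemma tnth_pi_inj : injective (tnth pi).
Proof. by apply/tuple_uniqP. Qed.

Lemma descent_inj : injective (@descent n pi).
Proof.
by apply/tuple_uniqP; rewrite filter_uniq // enum_uniq.
Qed.

Lemma descentP d : reflect (exists a : 'I_(ndes pi), descent a = d) (d \in D).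
Proof.
rewrite inE; apply: (iffP idP) => [dD|[a <-]].
  have : d \in descents pi by rewrite mem_filter dD mem_enum.
  by move=> /(tnthP (in_tuple (descents pi)))[a ->]; exists a.
by have := mem_tnth a (in_tuple (descents pi)); rewrite mem_filter => /andP[].
Qed.

(** The color index of the hook starting at [d]; the default [ord0] is taken only off the
    descents. *)
Definition descent_color (d : 'I_n) : 'I_(ndes pi).+1 :=
  if [pick a | @descent n pi a == d] is Some a then lift ord0 a else ord0.

Lemma descent_colorE (a : 'I_(ndes pi)) : descent_color (descent a) = lift ord0 a.
Proof.
rewrite /descent_color; case: pickP => [b /eqP/descent_inj->//|/(_ a)].
by rewrite eqxx.
Qed.

Lemma VHCP (H : (ndes pi).-tuple (hook n)) (J : 'I_n -> 'I_n) :
  (forall a, tnth H a = (descent a, J (descent a))) ->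
  VHC R pi H <-> noncrossing_arcs (tnth pi) [set: 'I_n]%SET D J.
Proof.
move=> HE; split.
  move=> [hook_ok _ no_above no_cross].
  have J_lt d : d \in D -> (d < J d)%N.
    by move=> /descentP[a <-]; have := hook_ok a; rewrite HE => /andP[].
  have J_max d (x : 'I_n) : d \in D -> (d <= x < J d)%N ->
      (tnth pi x < tnth pi (J d))%N.
    move=> /descentP[a <-] /andP[]; rewrite leq_eqVlt => /orP[/eqP/val_inj<- _|dx xJ].
      by have := hook_ok a; rewrite HE => /andP[].
    have := no_above a x; rewrite HE /directly_above /= dx xJ /= -leqNgt.
    rewrite leq_eqVlt => /orP[/eqP/tnth_pi_inj xE|//].
    by rewrite xE ltnn in xJ.
  split=> // [d dD|d x dD _|d d']; [by rewrite inE| exact: J_max|].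
  move=> dD d'D /andP[dd' d'J]; rewrite ltnNge; apply/negP => JJ.
  have [a da] := descentP _ dD; have [b db] := descentP _ d'D.
  have ab : a != b by apply: contraTneq dd' => abE; rewrite -da -db abE ltnn.
  (* If the arcs crossed, the horizontal segment of the hook at [d] would meet the vertical segment
     of the hook at [d'] in this point, which is not a shared endpoint. *)
  have := no_cross a b ab ((d' : nat)%:R, (tnth pi (J d))%:R).
  rewrite !HE da db /hook_points /plot_point /=.
  case.
  - by right; split=> //; rewrite !ler_nat (ltnW dd') (ltnW d'J).
  - left; split=> //; rewrite !ler_nat ltnW ?J_max ?(ltnW dd') //=.
    case: (ltngtP (J d) (J d')) JJ => // [JJ _|/val_inj->//].
    by rewrite ltnW // J_max // JJ ltnW.
  - case=> /(congr1 fst)/= /eqP xE _; move: xE; rewrite eqr_nat => /eqP dJ.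
    by rewrite dJ ltnn in d'J.
  - case=> /(congr1 fst)/= /eqP xE _; move: xE; rewrite eqr_nat => /eqP dJ.
    by have := J_lt _ d'D; rewrite -dJ ltnn.
move=> [_ J_lt J_max0 J_nest].
have J_max d (x : 'I_n) : d \in D -> (d <= x < J d)%N ->
    (tnth pi x < tnth pi (J d))%N.
  by move=> dD; apply: J_max0 dD (finset.in_setT x).
have descD (a : 'I_(ndes pi)) : descent a \in D by apply/descentP; exists a.
have J_top (a : 'I_(ndes pi)) : (tnth pi (descent a) < tnth pi (J (descent a)))%N.
  by apply: J_max; rewrite ?leqnn ?J_lt.
split.
- by move=> a; rewrite HE /is_hook /= J_lt //= J_top.
- by move=> a; rewrite HE.
- move=> a x; rewrite HE /directly_above /=; apply/negP => /andP[/andP[dx xJ]].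
  by rewrite ltnNge ltnW // J_max // ltnW.
(* The later hook lies weakly right of [d'] and weakly below height [pi (J d')], so a common point
   is on the horizontal segment of the earlier one. If [d' < J d], nesting puts that segment
   strictly higher; hence [J d = d'] and the point is the shared endpoint. *)
have meet (a b : 'I_(ndes pi)) q : (descent a < descent b)%N ->
    hook_points pi (tnth H a) q -> hook_points pi (tnth H b) q ->
    q = plot_point R pi (tnth H a).2 /\ q = plot_point R pi (tnth H b).1.
  rewrite !HE /hook_points /plot_point /=.
  set d := descent a; set d' := descent b => dd'.
  have dR : ((d : nat)%:R < (d' : nat)%:R :> R) by rewrite ltr_nat.
  have xb : hook_points pi (d', J d') q ->
      (d' : nat)%:R <= q.1 /\ q.2 <= (tnth pi (J d'))%:R.
    by case=> -[/= -> /andP[lo hi]]; split.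
  move=> qa qb; have [d'q qJ'] := xb qb.
  case: qa => -[q1 /andP[h1 h2]]; first by move: d'q; rewrite q1 leNgt dR.
  case: (leqP (J d) d') => [Jd'|d'J]; last first.
    have JJ := J_nest _ _ (descD a) (descD b); rewrite -/d -/d' dd' d'J in JJ.
    have pJ : (tnth pi (J d') < tnth pi (J d))%N.
      apply: J_max; rewrite ?descD // JJ // andbT.
      exact: ltnW (ltn_trans dd' (J_lt _ (descD b))).
    by move: qJ'; rewrite q1 ler_nat leqNgt pJ.
  have JE : J d = d'.
    apply: val_inj; apply/eqP; rewrite eqn_leq Jd' /= -(ler_nat R).
    exact: le_trans h2.
  have q1E : q.1 = (d' : nat)%:R.
    by apply/eqP; rewrite eq_le d'q andbT -[X in _ <= X%:R]/(d' : nat) -JE h2.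
  by rewrite JE; move: q1; rewrite JE => q2E; rewrite -q1E -q2E -surjective_pairing.
move=> a b ab q qa qb.
case: (ltngtP (descent a) (descent b)) => [lt|lt|/val_inj/descent_inj abE].
- by left; apply: meet.
- by right; apply: meet.
- by rewrite abE eqxx in ab.
Qed.

(** By [arc_max] a point under an arc is directly below the hook, and of two nested arcs over [x]
    the one starting later ends strictly lower. So the lowest hook above [x] is the innermost
    arc. *)
Lemma has_colorE (H : (ndes pi).-tuple (hook n)) (J : 'I_n -> 'I_n) x c :
  (forall a, tnth H a = (descent a, J (descent a))) ->
  noncrossing_arcs (tnth pi) [set: 'I_n]%SET D J ->
  has_color H x c =
    (x \notin (J @: D)%SET) && (arc_color descent_color D J ord0 x == c).
Proof.
move=> HE [_ J_lt J_max0 J_nest].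
have J_max d (y : 'I_n) : d \in D -> (d <= y < J d)%N ->
    (tnth pi y < tnth pi (J d))%N.
  by move=> dD; apply: J_max0 dD (finset.in_setT y).
have descD (a : 'I_(ndes pi)) : descent a \in D by apply/descentP; exists a.
have belowE (a : 'I_(ndes pi)) : directly_below pi x (tnth H a) =
    (descent a < x < J (descent a))%N.
  rewrite HE /directly_below /=; apply: andb_idr => /andP[dx xJ].
  by rewrite J_max // xJ ltnW.
rewrite /has_color; congr (~~ _ && _).
  apply/existsP/imsetP => [[a /eqP<-]|[d /descentP[a <-] ->]].
    by exists (descent a); rewrite ?HE.
  by exists a; rewrite HE.
have [/existsP[d /andP[dD dx]]|] :=
    boolP [exists d, (d \in D) && (d < x < J d)%N]; last first.
  rewrite negb_exists => /forallP no_arc.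
  have no_arc' a : ~~ directly_below pi x (tnth H a).
    by have := no_arc (descent a); rewrite belowE descD.
  rewrite arc_color_none => [|d dD]; last by have := no_arc d; rewrite dD.
  case: unliftP => [a ->|->]; last by rewrite eqxx; apply/forallP.
  by rewrite /lowest_hook_above (negPf (no_arc' a)).
have [d0 inn] := innermost_exists dD dx.
rewrite (arc_color_innermost _ _ inn).
case/and3P: inn => /descentP[a0 <-] d0x /forall_inP d0_max.
rewrite descent_colorE.
case: unliftP => [a ->|->]; last first.
  by apply/forallP => /(_ a0); rewrite belowE d0x.
have lt_top (a1 a2 : 'I_(ndes pi)) : (descent a1 < descent a2)%N ->
    directly_below pi x (tnth H a1) -> directly_below pi x (tnth H a2) ->
    (tnth pi (tnth H a2).2 < tnth pi (tnth H a1).2)%N.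
  rewrite !belowE !HE /= => lt_d h1 h2.
  have JJ : (J (descent a2) < J (descent a1))%N by apply: J_nest => //; lia.
  by apply: J_max => //; lia.
rewrite (inj_eq lift_inj); apply/andP/eqP => [[ax /forallP low]|<-].
  apply: descent_inj; apply: val_inj; apply/eqP; rewrite eq_sym.
  have := implyP (d0_max _ (descD a)); rewrite -belowE ax => /(_ isT).
  rewrite leq_eqVlt => /orP[//|lt_d].
  have := lt_top _ _ lt_d ax; have := low a0; rewrite !belowE d0x /=.
  by rewrite leqNgt => /negPf-> /(_ isT).
rewrite belowE d0x; split=> //; apply/forallP => b; apply/implyP => bx.
have := implyP (d0_max _ (descD b)); rewrite -belowE bx => /(_ isT).
rewrite leq_eqVlt => /orP[/eqP/val_inj/descent_inj->//|lt_d].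
by apply: ltnW; apply: lt_top; rewrite // belowE.
Qed.

Lemma composition_of_arc_weight (H : (ndes pi).-tuple (hook n)) (J : 'I_n -> 'I_n) :
  (forall a, tnth H a = (descent a, J (descent a))) ->
  noncrossing_arcs (tnth pi) [set: 'I_n]%SET D J ->
  composition_of H =
    arc_weight (@std_basis _) descent_color [set: 'I_n]%SET D J ord0.
Proof.
move=> HE nc; apply/rowP => c; rewrite /arc_weight summxE mxE.
rewrite -sum1_card big_mkcond [RHS]big_mkcond /= -natz natr_sum.
apply: eq_bigr => x _; rewrite !inE /= (has_colorE _ _ HE nc).
case: (_ \notin _) => //=; rewrite mxE eqxx /= eq_sym; by case: (_ == _).
Qed.

Lemma valid_compositions_weight v :
  valid_compositions R pi v <->
  is_weight (tnth pi) (@std_basis _) descent_color [set: 'I_n]%SET D ord0 v.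
Proof.
split=> [[H HV <-]|[J nc ->]].
  pose J d := if [pick a | @descent n pi a == d] is Some a then (tnth H a).2 else d.
  have HE (a : 'I_(ndes pi)) : tnth H a = (descent a, J (descent a)).
    rewrite /J; case: pickP => [b /eqP/descent_inj->|/(_ a)]; last by rewrite eqxx.
    by case: HV => _ <- _ _; rewrite -surjective_pairing.
  have nc := (VHCP HE).1 HV.
  by exists J => //; apply: composition_of_arc_weight.
pose H := [tuple (descent a, J (descent a)) | a < ndes pi].
have HE (a : 'I_(ndes pi)) : tnth H a = (descent a, J (descent a)) by rewrite tnth_mktuple.
by exists H; [apply/(VHCP HE) | apply: composition_of_arc_weight].
Qed.

End Hooks.

(** * Conclusion: all positions, the sky as surrounding color, and an empty tail *)

Local Open Scope classical_set_scope.

Theorem mainTheorem3 (R : realType) (n : nat) (pi : n.-tuple nat)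
  (pi_perm : is_permutation pi)
  (V_nonempty : valid_compositions R pi !=set0) :
  transversal_discrete_polymatroid (valid_compositions R pi).
Proof.
have /and3P[_ pi_uniq _] := pi_perm.
suff form : has_transversal_form (valid_compositions R pi).
  by split=> //; apply: transversal_form_polymatroid.
have [|r0 [Ks KsP]] := is_weight_sumset (@std_basis _) (@descent_color n pi)
  (D := [set i | is_descent pi i]%SET) ord0 (tnth_pi_inj pi_uniq) (finset.subsetT _).
  (* Adjacency within the full set of positions forces [b] to be [a + 1]: otherwise [a + 1] would
     lie strictly between. *)
  move=> a b _ _ ab pab cons; rewrite inE; apply/existsP; exists b.
  rewrite pab andbT eqn_leq ab andbT leqNgt; apply/negP => ab'.
  have := cons (Ordinal (ltn_trans ab' (ltn_ord b))); rewrite inE /= ltnSn ab'.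
  by move/(_ isT).
have tail0 : rising_tail (tnth pi) [set: 'I_n]%SET finset.set0.
  by split=> [a t|t t']; rewrite !inE.
have := KsP _ tail0; rewrite finset.setU0 cards0 => {}KsP.
(* One valid composition gives [r0 <= 0], so the threshold condition disappears and the valid
   compositions form exactly the Minkowski sum. *)
have [v0 /(valid_compositions_weight R pi_uniq)/KsP[r00 _]] := V_nonempty.
apply: in_sumset_transversal_form V_nonempty => v.
rewrite valid_compositions_weight // KsP r00.
by split=> [[_ h]|h]; [exact: h | split].
Qed.
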